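(* Let $k$ be an algebraically closed field, let $V$ be a finite dimensional $k$-vector space, $G=GL(V)$, $\mathfrak g=\mathrm{End}(V)$. Let $V=\bigoplus_{i\in\mathbf Z}V_i$ be a good grading of $V$ and let $\delta:k^*\to G$ be the corresponding cocharacter, $\delta(a)|_{V_r}=a^r$ for all $a\in k^*$, $r\in\mathbf Z$. Then $$\mathfrak g_2^{\delta!}=\mathrm{End}(V)_2^0 ,$$ that is: for $A\in\mathrm{End}(V)$ with $A(V_r)\subset V_{r+2}$ for all $r$, the centralizer of $A$ in $G$ is contained in $G^\delta_{\ge0}$ if and only if $A^n:V_{-n}\to V_n$ is an isomorphism for every $n\ge0$.
   Context: A $\mathbf Z$-grading $V=\bigoplus_{i\in\mathbf Z}V_i$ is good if $\dim V_i=\dim V_{-i}\ge\dim V_{-i-2}$ for all $i\ge0$. (The cocharacters $\delta$ obtained from good gradings form the set denoted $\mathfrak D_G$.) For $i\in\mathbf Z$, $\mathfrak g_i^\delta=\{x\in\mathfrak g;\mathrm{Ad}(\delta(a))x=a^ix\ \forall a\in k^*\}=\mathrm{End}(V)_i=\{A\in\mathrm{End}(V);A(V_r)\subset V_{r+i}\ \forall r\}$. $G^\delta_{\ge0}$ is the parabolic subgroup of $G$ with Lie algebra $\bigoplus_{j\ge0}\mathfrak g_j^\delta$, i.e. the stabilizer in $G$ of all subspaces $V_{\ge a}=\sum_{j\ge a}V_j$. For $x\in\mathfrak g$, $G_x=\{g\in G;\mathrm{Ad}(g)x=x\}$, and $\mathfrak g_2^{\delta!}=\{x\in\mathfrak g_2^\delta;G_x\subset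 G^\delta_{\ge0}\}$. $\mathrm{End}(V)_2^0$ is the set of all $A\in\mathrm{End}(V)_2$ such that $A^n:V_{-n}\to V_n$ is an isomorphism for any $n\ge0$. *)

(* Defs.v *)
From HB Require Import structures.
From mathcomp Require Import all_boot all_order all_algebra.

Set Implicit Arguments.
Unset Strict Implicit.
Unset Printing Implicit Defensive.

Import Order.TTheory GRing.Theory Num.Theory.
Local Open Scope ring_scope.

Section Defs.
Variables (k : fieldType) (V : vectType k).
Implicit Types (Vg : int -> {vspace V}) (delta : k -> 'End(V)).
Implicit Types (g x A f : 'End(V)) (U W : {vspace V}).

(* V is the internal direct sum of the Vg i, i in Z: every finite subfamily is
   independent, and every vector lies in a finite subsum. *)
Definition is_grading Vg : Prop :=
  (forall s : seq int, uniq s -> directv (\sum_(i <- s) Vg i)%VS) /\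
  (forall v : V, exists s : seq int, v \in (\sum_(i <- s) Vg i)%VS).

Definition good_grading Vg : Prop :=
  is_grading Vg /\
  forall i : int, 0 <= i ->
    \dim (Vg i) = \dim (Vg (- i)%R) /\
    (\dim (Vg (- i - 2)%R) <= \dim (Vg (- i)%R))%N.

(* 'End(V) is not assumed to be a ring because V may be 0; elements of GL(V)
   are therefore singled out as the bijective endomorphisms. *)
Definition in_GL g : Prop := bijective g.

Definition Ad g x : 'End(V) := (g \o x \o g^-1)%VF.

(* The value of delta at 0 is irrelevant: only k^* matters. *)
Definition cocharacter_of Vg delta : Prop :=
  forall a : k, a != 0 ->
    in_GL (delta a) /\
    forall (r : int) (v : V), v \in Vg r -> delta a v = a ^ r *: v.

Definition g_deg delta (i : int) x : Prop :=
  forall a : k, a != 0 -> Ad (delta a) x = a ^ i *: x.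

Definition End_deg Vg (i : int) A : Prop :=
  forall r : int, (A @: Vg r <= Vg (r + i)%R)%VS.

(* v lies in the (a priori infinite) sum of the Vg j with j >= a. *)
Definition in_Vge Vg (a : int) (v : V) : Prop :=
  exists2 s : seq int, all (fun j => a <= j) s & v \in (\sum_(j <- s) Vg j)%VS.

(* The stabilizer in GL(V) of all V_{>= a}, i.e. g (V_{>= a}) = V_{>= a}. *)
Definition in_Gge0 Vg g : Prop :=
  in_GL g /\
  forall (a : int) (w : V),
    in_Vge Vg a w <-> exists2 v : V, in_Vge Vg a v & g v = w.

Definition centralizer_GL x g : Prop := in_GL g /\ Ad g x = x.

Definition g2_shriek Vg delta x : Prop :=
  g_deg delta 2 x /\ forall g, centralizer_GL x g -> in_Gge0 Vg g.

Definition lfun_pow A (n : nat) : 'End(V) :=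
  iter n (fun B : 'End(V) => (A \o B)%VF) \1%VF.

Definition restricts_to_iso f U W : Prop :=
  (f @: U)%VS = W /\ {in U &, injective f}.

Definition End2_0 Vg A : Prop :=
  End_deg Vg 2 A /\
  forall n : nat, restricts_to_iso (lfun_pow A n) (Vg (- n%:Z)) (Vg n%:Z).

End Defs.

(* Main.v *)
Require Import Defs.
From HB Require Import structures.
From mathcomp Require Import all_boot all_order all_algebra.
From mathcomp Require Import zify.
Import Order.TTheory GRing.Theory Num.Theory.
Local Open Scope ring_scope.

(** If every A^n : V_{-n} -> V_n is an isomorphism, then V is generated under A
    by the v in V_{-n} with A^{n+1} v = 0.  An f commuting with A and of degree
    i < 0 sends such a v to an element of V_{-n+i} killed by A^{n+1}, hence to 0
    because A^{n-i} is injective there; so f = 0, and an element of the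
    centralizer of A has only components of degree >= 0.

    Conversely, an f of negative degree commuting with A is 0 as soon as the
    centralizer of A stabilizes the filtration, because 1 + f is then in the
    centralizer.  If A^n : V_{-n} -> V_n is not injective, it is not surjective
    either, the dimensions being equal, and there is a rank one E : V_n -> V_{-n}
    with A^n E = E A^n = 0.  For the least c with A^{c+1} E = E A^{c+1} = 0, the
    sum of the A^j E A^{c-j}, 0 <= j <= c, commutes with A, is nonzero, and has
    degree 2c - 2n < 0. *)

(** * Gradings of a finite dimensional space and their projections *)

Section Gradings.
Context {k : fieldType} {V : vectType k}.
Implicit Types (Vg : int -> {vspace V}).

Lemma memv_sum_seq {Vg} (s : seq int) (w : int -> V) :
  (forall i, i \in s -> w i \in Vg i) ->
  \sum_(i <- s) w i \in (\sum_(i <- s) Vg i)%VS.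
Proof.
elim: s => [|i s IHs] wV; first by rewrite !big_nil mem0v.
rewrite !big_cons memv_add ?wV ?mem_head // IHs // => j js.
by rewrite wV // inE js orbT.
Qed.

Lemma subv_sum_seq {Vg} (s : seq int) (U : {vspace V}) :
  (forall i, i \in s -> (Vg i <= U)%VS) -> (\sum_(i <- s) Vg i <= U)%VS.
Proof.
elim: s => [|i s IHs] sU; first by rewrite big_nil sub0v.
rewrite big_cons subv_add sU ?mem_head // IHs // => j js.
by rewrite sU // inE js orbT.
Qed.

(** Directness over [s] and over [i :: s] makes dimensions additive, which leaves dimension 0 for
    the intersection. *)
Lemma grading_disjoint {Vg} (s : seq int) i :
  is_grading Vg -> uniq (i :: s) -> (Vg i :&: \sum_(j <- s) Vg j = 0)%VS.
Proof.
move=> [dVg _] us; have /andP[_ us'] := us.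
have := dVg _ us; have := dVg _ us'; rewrite !directvE /= !big_cons.
move=> /eqP ds /eqP dis.
apply/eqP; rewrite -dimv_eq0; have := dimv_sum_cap (Vg i) (\sum_(j <- s) Vg j)%VS.
by rewrite dis ds; lia.
Qed.

Lemma grading_independent {Vg} (s : seq int) (w : int -> V) :
  is_grading Vg -> uniq s -> (forall i, w i \in Vg i) ->
  \sum_(i <- s) w i = 0 -> forall i, i \in s -> w i = 0.
Proof.
move=> gVg us wV; elim: s us => // j s IHs us; rewrite big_cons => w0.
have wj0 : w j = 0.
  apply/eqP; rewrite -memv0 -(grading_disjoint s j gVg us) memv_cap wV /=.
  rewrite -[w j](addrK (\sum_(i <- s) w i)) w0 sub0r rpredN.
  by apply: memv_sum_seq => i _.
move=> i; rewrite inE => /predU1P[-> //|].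
apply: (IHs _ _ i); first by case/andP: us.
by move: w0; rewrite wj0 add0r.
Qed.

(** The list [S] contains every degree with a nonzero piece, so sums over all integers become
    finite; [pr r] still makes sense for [r] outside [S], where it is 0. *)
Definition graded_projections Vg (S : seq int) (pr : int -> 'End(V)) : Prop :=
  [/\ forall r v, pr r v \in Vg r,
      forall r v, v \in Vg r -> pr r v = v,
      forall r s v, v \in Vg r -> s != r -> pr s v = 0
    & forall v, v = \sum_(i <- S) pr i v].

(** Each vector of a finite basis needs finitely many degrees; their union serves for all of [V]. *)
Lemma grading_finite_support {Vg} : is_grading Vg ->
  exists2 S : seq int, uniq S & (\sum_(i <- S) Vg i)%VS = fullv.
Proof.
move=> [_ spanVg].
have sumS (s t : seq int) :
    {subset s <= t} -> (\sum_(i <- s) Vg i <= \sum_(i <- t) Vg i)%VS.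
  move=> sst; apply: subv_sum_seq => i /sst it.
  by rewrite (big_rem i it) addvSl.
have /(_ (vbasis fullv))[S bS] (b : seq V) : exists S : seq int,
    forall v, v \in b -> v \in (\sum_(i <- S) Vg i)%VS.
  elim: b => [|v b [S bS]]; first by exists [::].
  have [s vs] := spanVg v; exists (s ++ S) => u; rewrite inE => /predU1P[->|ub].
    by apply: (subvP _ _ vs); apply: sumS => i si; rewrite mem_cat si.
  apply: (subvP _ _ (bS u ub)); apply: sumS => i si.
  by rewrite mem_cat si orbT.
exists (undup S); first exact: undup_uniq.
apply/eqP; rewrite eqEsubv subvf /= -(span_basis (vbasisP fullv)).
apply/span_subvP => v /bS; apply/subvP; apply: sumS => i.
by rewrite mem_undup.
Qed.

Lemma graded_projections_exist {Vg} : is_grading Vg ->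
  exists S pr, graded_projections Vg S pr.
Proof.
move=> gVg; have [S uS VS] := grading_finite_support gVg.
pose pr := sumv_pi_for (esym VS).
have prV r v : pr r v \in Vg r by apply: memv_sum_pi.
have prS v : v = \sum_(i <- S) pr i v.
  by rewrite sumv_pi_uniq_sum ?memvf // filter_predT.
have supp r v : v \in Vg r -> r \notin S -> v = 0.
  move=> vr rS; apply/eqP; rewrite -memv0 -(grading_disjoint S r gVg).
    by rewrite VS capvf.
  by rewrite /= rS.
have prE r s v : v \in Vg r -> pr s v = if s == r then v else 0.
  move=> vr; have [rS|rS] := boolP (r \in S); last first.
    by rewrite (supp r v) // linear0 if_same.
  have [sS|sS] := boolP (s \in S); last first.
    rewrite (supp s _ (prV s v)) //; case: eqP => // sr.
    by rewrite sr rS in sS.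
  apply/eqP; rewrite -subr_eq0; apply/eqP.
  (* Both families are homogeneous decompositions of [v]; their difference sums to 0, so
     independence kills each term. *)
  pose w i := pr i v - (if i == r then v else 0).
  apply: (grading_independent S w gVg uS _ _ s sS) => [i|].
    by rewrite rpredB ?prV //; case: eqP => [->|_] //; apply: mem0v.
  rewrite sumrB -prS -big_mkcond /= (big_rem r rS) eqxx /= big_seq_cond.
  rewrite big_pred0 ?addr0 ?subrr // => i.
  by rewrite mem_rem_uniq // inE; case: eqP; rewrite ?andbF.
exists S, pr; split=> // [r v vr|r s v vr sr].
  by rewrite (prE r) // eqxx.
by rewrite (prE r) // (negPf sr).
Qed.

End Gradings.

(** * Homogeneous components of vectors and homogeneous endomorphisms *)

Section GradedMaps.
Context {k : fieldType} {V : vectType k} {Vg : int -> {vspace V}}.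
Context {S : seq int} {pr : int -> 'End(V)}.
Context (prP : graded_projections Vg S pr).
Implicit Types (A f g : 'End(V)).

Lemma pr_mem r v : pr r v \in Vg r. Proof. by case: prP. Qed.

Lemma pr_id r v : v \in Vg r -> pr r v = v.
Proof. by case: prP => _ + _ _; apply. Qed.

Lemma pr_neq r s v : v \in Vg r -> s != r -> pr s v = 0.
Proof. by case: prP => _ _ + _; apply. Qed.

Lemma pr_sum v : v = \sum_(i <- S) pr i v. Proof. by case: prP. Qed.

Lemma pr_eq0 v : (forall i, pr i v = 0) -> v = 0.
Proof. by move=> v0; rewrite (pr_sum v) big1. Qed.

Lemma mem_pr r v : (forall s, s != r -> pr s v = 0) -> v \in Vg r.
Proof.
by move=> vr; rewrite (pr_sum v) rpred_sum // => i _; have [->|/vr ->] := eqVneq i r;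
  rewrite ?pr_mem ?mem0v.
Qed.

Lemma grading_bounded :
  exists N : nat, forall (r : int) v, (N < `|r|)%N -> v \in Vg r -> v = 0.
Proof.
exists (\max_(i <- S) `|i|%N) => r v ltr vr; rewrite (pr_sum v) big_seq big1 // => i iS.
apply: (pr_neq _ _ _ vr); apply: contraTneq ltr => <-.
by rewrite -leqNgt; apply: (leq_bigmax_seq i).
Qed.

(** Makes membership in the filtration testable component by component. *)
Lemma in_VgeP a v : in_Vge Vg a v <-> forall j : int, j < a -> pr j v = 0.
Proof.
split=> [[s /allP sa vs] j ja | v0].
  apply/eqP; rewrite -memv_ker; apply: (subvP _ _ vs); apply: subv_sum_seq.
  move=> i /sa ai; apply/subvP => u ui; rewrite memv_ker; apply/eqP.
  by apply: (pr_neq _ _ _ ui); rewrite lt_eqF // (lt_le_trans ja ai).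
exists [seq i <- S | a <= i]; first exact: filter_all.
rewrite {1}(pr_sum v) (bigID (fun i => a <= i)) /=.
rewrite [X in _ + X]big1 => [|i]; last by rewrite -ltNge => /v0.
by rewrite addr0 -big_filter; apply: memv_sum_seq => i _; apply: pr_mem.
Qed.

Lemma End_degP d A :
  End_deg Vg d A <-> forall r v, v \in Vg r -> A v \in Vg (r + d).
Proof.
split=> [dA r v vr | dA r].
  by apply: (subvP (dA r)); apply: memv_img.
by apply/subvP => _ /memv_imgP[v vr ->]; apply: dA.
Qed.

Lemma lfun_eq_graded f g :
  (forall r v, v \in Vg r -> f v = g v) -> f = g.
Proof.
move=> fg; apply/lfunP => v; rewrite (pr_sum v) !linear_sum.
by apply: eq_bigr => i _; rewrite /= (fg i) ?pr_mem.
Qed.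

Lemma pr_End_deg d A : End_deg Vg d A ->
  forall r v, pr (r + d) (A v) = A (pr r v).
Proof.
move/End_degP => dA r v; rewrite -!comp_lfunE; congr (fun_of_lfun _ v).
apply: lfun_eq_graded => s u us; rewrite !comp_lfunE /=.
have [sr|sr] := eqVneq r s; first by rewrite sr !pr_id ?dA.
by rewrite (pr_neq _ _ _ us sr) linear0 (pr_neq _ _ _ (dA _ _ us)) // (inj_eq (addIr d)).
Qed.

Lemma lfun_powD A m n v : lfun_pow A (m + n) v = lfun_pow A m (lfun_pow A n v).
Proof.
elim: m => [|m IHm]; first by rewrite add0n id_lfunE.
by rewrite addSn /= !comp_lfunE /= IHm.
Qed.

Lemma lfun_powS A n v : lfun_pow A n.+1 v = A (lfun_pow A n v).
Proof. by rewrite /= comp_lfunE. Qed.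

Lemma lfun_powSr A n v : lfun_pow A n.+1 v = lfun_pow A n (A v).
Proof. by rewrite -addn1 lfun_powD lfun_powS id_lfunE. Qed.

Lemma lfun_pow_deg A d n :
  End_deg Vg d A -> End_deg Vg (d * n%:Z) (lfun_pow A n).
Proof.
move=> /End_degP dA; apply/End_degP; elim: n => [|n IHn] r v vr.
  by rewrite id_lfunE mulr0 addr0.
rewrite lfun_powS; have -> : r + d * n.+1%:Z = r + d * n%:Z + d by lia.
by rewrite dA // IHn.
Qed.

Lemma Ad_fixP (x : 'End(V)) g : in_GL g ->
  Ad g x = x <-> forall v, g (x v) = x (g v).
Proof.
move=> [g' gK g'K].
have kg : lker g == 0%VS by apply/lker0P; apply: can_inj gK.
rewrite /Ad; split=> [Ex v | gx].
  by rewrite -{2}Ex !comp_lfunE /= lker0_lfunK.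
apply/lfunP => v; rewrite !comp_lfunE /= gx lker0_lfunVK //.
Qed.


Lemma lfun_pow_comm f A n v : (forall w, f (A w) = A (f w)) ->
  f (lfun_pow A n v) = lfun_pow A n (f v).
Proof.
move=> fA; elim: n => [|n IHn]; first by rewrite !id_lfunE.
by rewrite !lfun_powS fA IHn.
Qed.

(** * From the isomorphisms to the centralizer *)

(** Here [f] need not be homogeneous: [pr (r + i) (f v)] is the value at [v] of its component of
    degree [i], which again commutes with [A]. *)
Lemma commuting_lowering_eq0 A f : End_deg Vg 2 A ->
  (forall n : nat, restricts_to_iso (lfun_pow A n) (Vg (- n%:Z)) (Vg n%:Z)) ->
  (forall v, f (A v) = A (f v)) ->
  forall (i r : int) v, i < 0 -> v \in Vg r -> pr (r + i) (f v) = 0.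
Proof.
move=> dA isoA fA i r v i0; have /End_degP dA1 := dA.
have prA n s w : pr (s + 2 * n%:Z) (lfun_pow A n w) = lfun_pow A n (pr s w).
  exact/pr_End_deg/lfun_pow_deg.
have [N bN] := grading_bounded.
(* Induction starting from the very negative degrees, where the pieces vanish; [m] bounds the number
   of steps left. *)
have neg m : forall (n : nat) w, (N < n + m)%N -> w \in Vg (- n%:Z) ->
    pr (- n%:Z + i) (f w) = 0.
  elim: m => [|m IHm] n w Nn wn.
    by rewrite (bN _ _ _ wn) ?linear0 //; lia.
  (* Splits [w] as [A u] plus a primitive part: choosing [u] with A^(n+2) u = A^(n+1) w makes
     A^(n+1) kill [w - A u]. *)
  have /memv_imgP[u un Au] :
      lfun_pow A n.+1 w \in (lfun_pow A n.+2 @: Vg (- n.+2%:Z))%VS.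
    rewrite (isoA n.+2).1; have -> : n.+2%:Z = - n%:Z + 2 * n.+1%:Z by lia.
    by have /End_degP := lfun_pow_deg _ _ n.+1 dA; apply.
  have pAu : pr (- n%:Z + i) (f (A u)) = 0.
    have -> : - n%:Z + i = - n.+2%:Z + i + 2 by lia.
    by rewrite fA (pr_End_deg _ _ dA) (IHm n.+2) ?linear0 //; lia.
  rewrite -[w](subrK (A u)) linearD linearD /= pAu addr0.
  set p := w - A u.
  (* As [i < 0], the exponent [m'] = n - i is at least n + 1, so A^m' kills [p], while it is
     injective on the piece of degree -m'. *)
  have Ap : lfun_pow A n.+1 p = 0.
    by rewrite linearB /= Au (lfun_powSr A n.+1) subrr.
  pose m' := `|(- n%:Z + i)%R|%N.
  have Em : - n%:Z + i = - m'%:Z by rewrite /m'; lia.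
  apply: ((isoA m').2); rewrite -?Em ?pr_mem ?mem0v // linear0.
  have -> : m' = (m' - n.+1 + n.+1)%N by rewrite /m'; lia.
  by rewrite lfun_powD -prA -(lfun_pow_comm f) // Ap !linear0.
have [r0|r0] := ltP r 0 => vr.
  have Er : r = - `|r|%N%:Z by lia.
  by rewrite Er in vr *; apply: (neg N.+1) vr; lia.
(* In degree r >= 0 every vector is A^r u with [u] of degree -r, which reduces to [neg]. *)
have Er : r = `|r|%N%:Z by lia.
move: vr; rewrite Er -(isoA _).1 => /memv_imgP[u un ->].
have -> : `|r|%N%:Z + i = - `|r|%N%:Z + i + 2 * `|r|%N%:Z by lia.
by rewrite (lfun_pow_comm f) // prA (neg N.+1) ?linear0 //; lia.
Qed.

Lemma iso_centralizer A : End_deg Vg 2 A ->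
  (forall n : nat, restricts_to_iso (lfun_pow A n) (Vg (- n%:Z)) (Vg n%:Z)) ->
  forall g, centralizer_GL A g -> in_Gge0 Vg g.
Proof.
move=> dA isoA g [gG /(Ad_fixP _ _ gG) gA].
have stable f : (forall v, f (A v) = A (f v)) ->
    forall a v, in_Vge Vg a v -> in_Vge Vg a (f v).
  move=> fA a v /in_VgeP va; apply/in_VgeP => j ja.
  rewrite (pr_sum v) !linear_sum big1 // => s _ /=.
  have [sa|sa] := ltP s a; first by rewrite va ?linear0.
  have -> : j = s + (j - s) by lia.
  by rewrite (commuting_lowering_eq0 A) ?pr_mem //; lia.
split=> // a w; split=> [wa | [v va <-]]; last exact: stable.
(* The inverse of [g] also commutes with [A], so it preserves the filtration too; this upgrades
   inclusion to equality. *)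
have kg : lker g == 0%VS.
  by case: gG => g' gK _; apply/lker0P; apply: can_inj gK.
exists (g^-1%VF w); last by rewrite lker0_lfunVK.
apply: stable wa => v.
by rewrite -{1}[v](lker0_lfunVK kg) -gA lker0_lfunK.
Qed.

(** * From the centralizer to the isomorphisms *)

Lemma restricts_to_iso_ker f (U W : {vspace V}) :
  (f @: U <= W)%VS -> \dim U = \dim W -> (U :&: lker f = 0)%VS ->
  restricts_to_iso f U W.
Proof.
move=> fUW dUW kU; split.
  by apply/eqP; rewrite eqEdim fUW limg_dim_eq ?dUW /=.
move=> u v uU vU fuv; apply/eqP; rewrite -subr_eq0 -memv0 -kU memv_cap rpredB //=.
by rewrite memv_ker linearB /= fuv subrr.
Qed.

(** If v = - f v, the component of [v] in degree [r] is determined by the one in the higher degree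
    [r - d]; iterating passes the bound [N], so v = 0. *)
Lemma one_plus_lowering_GL f d : d < 0 -> End_deg Vg d f -> in_GL (\1 + f)%VF.
Proof.
move=> d0 df; have [N bN] := grading_bounded.
have k0 : lker (\1 + f)%VF == 0%VS.
  rewrite -subv0; apply/subvP => v; rewrite memv_ker memv0 add_lfunE id_lfunE.
  rewrite addr_eq0 => /eqP Ev.
  have prv0 (m : nat) : forall r : int, N%:Z < r + m%:Z -> pr r v = 0.
    elim: m => [|m IHm] r Nr; first by apply: (bN r); rewrite ?pr_mem //; lia.
    have -> : r = r - d + d by lia.
    by rewrite Ev linearN /= (pr_End_deg _ _ df) IHm ?linear0 ?oppr0 //; lia.
  by apply/eqP/pr_eq0 => r; apply: (prv0 (N + `|r|).+1); lia.
by exists (\1 + f)^-1%VF; [apply: lker0_lfunK | apply: lker0_lfunVK].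
Qed.

Lemma centralizing_lowering_eq0 A f d :
  (forall g, centralizer_GL A g -> in_Gge0 Vg g) ->
  d < 0 -> End_deg Vg d f -> (forall v, f (A v) = A (f v)) -> f = 0.
Proof.
move=> cA d0 df fA; have gG := one_plus_lowering_GL _ _ d0 df.
have [_ gge] : in_Gge0 Vg (\1 + f)%VF.
  apply: cA; split=> //; apply/(Ad_fixP _ _ gG) => v.
  by rewrite !add_lfunE !id_lfunE fA linearD.
apply: lfun_eq_graded => r v vr; rewrite zero_lfunE.
have vge : in_Vge Vg r v.
  by apply/in_VgeP => j jr; apply: (pr_neq _ _ _ vr); rewrite lt_eqF.
(* The component of v + f v in degree r + d < r is [f v], and the filtration forces it to vanish. *)
have /in_VgeP/(_ (r + d)) : in_Vge Vg r ((\1 + f)%VF v).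
  by apply/(gge r); exists v.
rewrite add_lfunE id_lfunE linearD /= (pr_End_deg _ _ df) (pr_id _ _ vr).
by rewrite (pr_neq _ _ _ vr) ?add0r; [apply; lia | lia].
Qed.

(** Composes [pr n] with a linear form that kills [U] but not all of [Vg n], and multiplies by [u].
    It is used with [u] in the kernel of A^n and [U] the image of A^n on degree -n. *)
Lemma homogeneous_rank_one (u : V) (m n : int) (U : {vspace V}) :
  u \in Vg m -> u != 0 -> ~~ (Vg n <= U)%VS ->
  exists E : 'End(V),
    [/\ E != 0, forall v, exists a, E v = a *: u,
        forall v, E v = E (pr n v) & forall v, pr n v \in U -> E v = 0].
Proof.
move=> um u0 /subvPn[v vn vU].
pose w := v - projv U v.
have w0 : w != 0.
  by apply: contraNneq vU => /eqP; rewrite subr_eq0 => /eqP->; apply: memv_proj.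
have [i wi] : exists i, coord (vbasis fullv) i w != 0.
  apply/existsP; apply: contraNT w0; rewrite negb_exists => /forallP wi.
  rewrite (coord_vbasis (memvf w)) big1 // => i _.
  by have := wi i; rewrite negbK => /eqP->; rewrite scale0r.
pose F x := coord (vbasis fullv) i (pr n x - projv U (pr n x)) *: u.
have linF : linear F.
  move=> a x y; rewrite /F scalerA -scalerDl; congr (_ *: u).
  rewrite -linearP /=; congr (coord _ _ _).
  by rewrite (linearP (pr n)) (linearP (projv U)) /= scalerBr opprD addrACA.
pose FM := GRing.isLinear.Build _ _ _ _ F linF.
pose FL : {linear V -> V} := HB.pack F FM.
exists (linfun FL); split=> [|x|x|x xU]; rewrite ?lfunE /= /F.
- apply/lfunPn; exists v; rewrite zero_lfunE (lfunE FL) /= /F (pr_id _ _ vn).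
  by rewrite scaler_eq0 negb_or wi u0.
- by exists (coord (vbasis fullv) i (pr n x - projv U (pr n x))).
- by rewrite (pr_id n (pr n x)) ?pr_mem.
- by rewrite projv_id // subrr linear0 scale0r.
Qed.


(* The commutator of A with the sum f of the A^j E A^(c-j) telescopes to
   A^(c+1) E - E A^(c+1); minimality of c gives A^c E != 0 or E A^c != 0, and f
   acts as A^c E on V_n and as E A^c on V_(n-2c). *)
Lemma exists_centralizing_lowering A n (E : 'End(V)) :
  End_deg Vg 2 A -> (0 < n)%N -> E != 0 ->
  (forall v, E v \in Vg (- n%:Z)) -> (forall v, E v = E (pr n%:Z v)) ->
  (forall v, lfun_pow A n (E v) = 0) -> (forall v, E (lfun_pow A n v) = 0) ->
  exists (d : int) (f : 'End(V)),
    [/\ d < 0, End_deg Vg d f, forall v, f (A v) = A (f v) & f != 0].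
Proof.
move=> dA n0 E0 Em Epr AE EA.
pose P c := (lfun_pow A c.+1 \o E == 0)%VF && (E \o lfun_pow A c.+1 == 0)%VF.
have exP : exists c, P c.
  exists n.-1; rewrite /P prednK //.
  by apply/andP; split; apply/eqP/lfunP => v; rewrite comp_lfunE zero_lfunE.
have [c /andP[/eqP AcE /eqP EAc] minc] := ex_minnP exP.
have cn : (c < n)%N.
  rewrite -(prednK n0) ltnS; apply: minc; rewrite /P prednK //.
  by apply/andP; split; apply/eqP/lfunP => v; rewrite comp_lfunE zero_lfunE.
(* For c > 0 this is minimality of [c]; for c = 0 it is [E0]. *)
have ntop : (lfun_pow A c \o E != 0)%VF || (E \o lfun_pow A c != 0)%VF.
  rewrite -negb_and; apply/negP; case: (c) minc => [_|b minb].
    by rewrite /= comp_lfun1l (negPf E0).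
  by move=> Pb; have := minb b Pb; rewrite ltnn.
have dAE j r v : v \in Vg r -> lfun_pow A j v \in Vg (r + 2 * j%:Z).
  by have /End_degP := lfun_pow_deg _ _ j dA; apply.
have E_neq r v : v \in Vg r -> r != n%:Z -> E v = 0.
  by move=> vr rn; rewrite Epr (pr_neq _ _ _ vr) ?linear0 // eq_sym.
pose f := (\sum_(j < c.+1) (lfun_pow A j \o (E \o lfun_pow A (c - j))))%VF.
have fE v : f v = \sum_(j < c.+1) lfun_pow A j (E (lfun_pow A (c - j) v)).
  by rewrite sum_lfunE; apply: eq_bigr => j _; rewrite !comp_lfunE.
exists (2 * c%:Z - 2 * n%:Z), f; split; first by lia.
- apply/End_degP => r v vr; rewrite fE rpred_sum // => j _.
  have vj := dAE (c - j)%N _ _ vr; have jc := ltn_ord j.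
  (* [E] is nonzero only on degree n, so a term survives only if A^(c-j) carries degree [r] to n. *)
  have [rn|rn] := eqVneq (r + 2 * (c - j)%N%:Z) n%:Z; last first.
    by rewrite (E_neq _ _ vj rn) linear0 mem0v.
  have -> : r + (2 * c%:Z - 2 * n%:Z) = - n%:Z + 2 * j%:Z by lia.
  exact: dAE.
(* [f (A v)] is the sum of [T j] for 0 <= j <= c, and [A (f v)] that for 1 <= j <= c + 1; the two
   end terms vanish. *)
- move=> v; pose T j := lfun_pow A j (E (lfun_pow A (c.+1 - j) v)).
  have T0 : T 0%N = 0.
    by rewrite /T id_lfunE subn0 -comp_lfunE EAc zero_lfunE.
  have Tc : T c.+1 = 0.
    by rewrite /T -comp_lfunE AcE zero_lfunE.
  transitivity (\sum_(j < c.+1) T j).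
    rewrite fE; apply: eq_bigr => j _; rewrite -lfun_powSr /T subSn //.
    by rewrite -ltnS.
  transitivity (\sum_(j < c.+2) T j); first by rewrite [RHS]big_ord_recr /= Tc addr0.
  rewrite big_ord_recl T0 add0r fE linear_sum; apply: eq_bigr => j _ /=.
  by rewrite /T /bump leq0n add1n subSS lfun_powS.
apply/lfunPn; case/orP: ntop => /lfunPn[x]; rewrite comp_lfunE zero_lfunE.
- rewrite Epr => x0; exists (pr n%:Z x); rewrite fE zero_lfunE.
  rewrite big_ord_recr big1 => [|j _] /=.
    by rewrite subnn id_lfunE add0r.
  rewrite (E_neq (n%:Z + 2 * (c - j)%N%:Z)) ?linear0 ?dAE ?pr_mem //.
  by have := ltn_ord j; lia.
rewrite Epr -[n%:Z](subrK (2 * c%:Z)) (pr_End_deg _ _ (lfun_pow_deg _ _ c dA)) => x0.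
exists (pr (n%:Z - 2 * c%:Z) x); rewrite fE zero_lfunE.
rewrite big_ord_recl big1 ?addr0 => [|j _] /=.
  by rewrite subn0 id_lfunE.
rewrite (E_neq (n%:Z - 2 * c%:Z + 2 * (c - bump 0 j)%N%:Z)) ?linear0 //.
  by rewrite dAE ?pr_mem.
by rewrite /bump leq0n; have := ltn_ord j; lia.
Qed.

Lemma centralizer_iso A : End_deg Vg 2 A ->
  (forall n : nat, \dim (Vg n%:Z) = \dim (Vg (- n%:Z))) ->
  (forall g, centralizer_GL A g -> in_Gge0 Vg g) ->
  forall n : nat, restricts_to_iso (lfun_pow A n) (Vg (- n%:Z)) (Vg n%:Z).
Proof.
move=> dA dimV cA n.
have dAE j r v : v \in Vg r -> lfun_pow A j v \in Vg (r + 2 * j%:Z).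
  by have /End_degP := lfun_pow_deg _ _ j dA; apply.
have EnN : - n%:Z + 2 * n%:Z = n%:Z by lia.
have AnV : (lfun_pow A n @: Vg (- n%:Z) <= Vg n%:Z)%VS.
  apply/subvP => _ /memv_imgP[v vn ->].
  by rewrite -[X in Vg X]EnN dAE.
apply: restricts_to_iso_ker; rewrite ?dimV //.
apply/eqP; apply: contraT => kerA.
have [u /memv_capP[un uker] u0] : exists2 u,
    u \in (Vg (- n%:Z) :&: lker (lfun_pow A n))%VS & u != 0.
  by exists (vpick (Vg (- n%:Z) :&: lker (lfun_pow A n))%VS);
    rewrite ?memv_pick ?vpick0.
have Au : lfun_pow A n u = 0 by apply/eqP; rewrite -memv_ker.
have n0 : (0 < n)%N.
  by case: n Au {dAE EnN AnV kerA un uker} => // /eqP; rewrite id_lfunE (negPf u0).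
(* Rank-nullity and equality of dimensions: a nonzero kernel makes the image too small. *)
have VnU : ~~ (Vg n%:Z <= lfun_pow A n @: Vg (- n%:Z))%VS.
  apply/negP => /dimvS; rewrite dimV -(limg_ker_dim (lfun_pow A n)).
  by rewrite -subn_eq0 addnK dimv_eq0 (negPf kerA).
have [E [E0 Eu Epr EU]] := homogeneous_rank_one _ _ _ _ un u0 VnU.
have [|||d [f [d0 df fA f0]]] := exists_centralizing_lowering A n E dA n0 E0 _ Epr.
- by move=> v; have [a ->] := Eu v; rewrite memvZ.
- by move=> v; have [a ->] := Eu v; rewrite linearZ /= Au scaler0.
- move=> v; apply: EU; rewrite -[X in pr X]EnN.
  by rewrite (pr_End_deg _ _ (lfun_pow_deg _ _ n dA)) memv_img ?pr_mem.
by case/eqP: f0; apply: centralizing_lowering_eq0 cA d0 df fA.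
Qed.

End GradedMaps.

(** * Weights of the cocharacter and degrees of endomorphisms *)

Lemma exists_exprz_neq (k : closedFieldType) (m n : int) :
  m != n -> exists2 a : k, a != 0 & a ^ m != a ^ n.
Proof.
move=> mn; pose N := `|(m - n)%R|%N.
have N0 : (0 < N)%N by rewrite /N absz_gt0 subr_eq0.
(* A root of X^(N+1) = X - 1 is nonzero and is not an N-th root of unity. *)
have [a] := solve_monicpoly (nth 0 [:: -1; 1 : k]) (ltn0Sn N).
rewrite -(prednK N0) 2!big_ord_recl /= big1 => [|i _]; last first.
  by rewrite nth_default ?mul0r.
rewrite expr0 expr1 mulr1 mul1r addr0 prednK // => Ea.
have a0 : a != 0.
  by apply: contra_eqN Ea => /eqP->; rewrite exprS mul0r addr0 eq_sym oppr_eq0 oner_eq0.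
exists a => //; apply: contra_eqN Ea => /eqP Emn.
have aN : a ^+ N = 1.
  have amn : a ^ (m - n) = 1 by rewrite expfzDr // -invr_expz Emn divff // expfz_neq0.
  rewrite /N; case: (m - n) amn => // j /= /(canRL invrK).
  by rewrite invr1.
rewrite exprS aN mulr1 -subr_eq0 opprD addrC addrNK; apply/negP.
by rewrite oppr_eq0 oppr_eq0 oner_eq0.
Qed.

(** For [v] of degree [r], [delta a] scales [x v] by a^(r+d) but its component of degree [s] by a^s;
    some [a] separates these when s differs from r + d. *)
Lemma g_deg_End_deg {k : closedFieldType} {V : vectType k}
    {Vg : int -> {vspace V}} {S pr delta} d (x : 'End(V)) :
  graded_projections Vg S pr -> cocharacter_of Vg delta ->
  g_deg delta d x <-> End_deg Vg d x.
Proof.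
move=> prP deltaP.
have kd a : a != 0 -> lker (delta a) == 0%VS.
  by move=> /deltaP[[g gK _] _]; apply/lker0P; apply: can_inj gK.
split=> [dx | /(End_degP _ _) dx a a0].
  apply/End_degP => r v vr; apply: (mem_pr prP) => s sr.
  have [a a0 aN] := exists_exprz_neq k s (r + d) sr.
  have [_ da] := deltaP a a0.
  have d0 : End_deg Vg 0 (delta a).
    by apply/End_degP => t u ut; rewrite addr0 (da t) // memvZ.
  have dax : delta a (x v) = a ^ (r + d) *: x v.
    have := congr1 (fun f : 'End(V) => f (delta a v)) (dx a a0).
    rewrite /Ad !comp_lfunE /= lker0_lfunK ?kd // => ->.
    by rewrite scale_lfunE (da r) // linearZ /= scalerA -expfzDr // addrC.
  have := congr1 (pr s) dax; rewrite linearZ /= -{1}[s]addr0.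
  rewrite (pr_End_deg prP _ _ d0) (da s) ?(pr_mem prP) //.
  move/eqP; rewrite -subr_eq0 -scalerBl scaler_eq0 subr_eq0 (negPf aN) /=.
  by move/eqP.
have [_ da] := deltaP a a0.
apply: (lfun_eq_graded prP) => r v vr.
have Ev : (delta a)^-1%VF v = a ^ (- r) *: v.
  apply: (lker0P (kd a a0)); rewrite lker0_lfunVK ?kd // linearZ /= (da r) //.
  by rewrite scalerA -expfzDr // addNr expr0z scale1r.
rewrite /Ad !comp_lfunE /= Ev !linearZ /= scale_lfunE (da (r + d)) ?dx //.
by rewrite scalerA -expfzDr // addKr.
Qed.

Theorem mainTheorem3 (k : closedFieldType) (V : vectType k)
    (Vg : int -> {vspace V}) (delta : k -> 'End(V))
    (hgood : good_grading Vg) (hdelta : cocharacter_of Vg delta) :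
  (forall A : 'End(V), g2_shriek Vg delta A <-> End2_0 Vg A) /\
  (forall A : 'End(V), End_deg Vg 2 A ->
     ((forall g : 'End(V), centralizer_GL A g -> in_Gge0 Vg g) <->
      (forall n : nat,
         restricts_to_iso (lfun_pow A n) (Vg (- n%:Z)) (Vg n%:Z)))).
Proof.
have [gVg dimVg] := hgood.
have [S [pr prP]] := graded_projections_exist gVg.
have dimV (n : nat) : \dim (Vg n%:Z) = \dim (Vg (- n%:Z)).
  by have [] := dimVg n%:Z isT.
have main (A : 'End(V)) : End_deg Vg 2 A ->
    ((forall g : 'End(V), centralizer_GL A g -> in_Gge0 Vg g) <->
     (forall n : nat,
        restricts_to_iso (lfun_pow A n) (Vg (- n%:Z)) (Vg n%:Z))).
  move=> dA; split; first exact: (centralizer_iso prP).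
  exact: (iso_centralizer prP).
split=> // A; split=> [[/(g_deg_End_deg _ _ prP hdelta) dA] | [dA]] /main.
  by move=> /(_ dA).
by move=> /(_ dA) cA; split=> //; apply/(g_deg_End_deg _ _ prP hdelta).
Qed.
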